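(* For every periodic $\ell$-pregroup $\mathbf{L}$, the lattices $\mathcal{C}(\mathbf{L})$ and $\mathcal{C}(\mathbf{L}_g)$ are isomorphic under the mutually inverse maps $H\mapsto H\cap L_g$ and $K\mapsto\overline{K}$, where $\overline{K}$ is the convex closure of $K$ in $\mathbf{L}$.
   Context: An $\ell$-pregroup is an algebra $(A,\wedge,\vee,\cdot,1,{}^{\ell},{}^{r})$ such that $(A,\wedge,\vee)$ is a lattice, $(A,\cdot,1)$ is a monoid, multiplication is order-preserving in both arguments, and $a^{\ell}a\le 1\le aa^{\ell}$ and $aa^{r}\le 1\le a^{r}a$ for all $a\in A$. Write $x^{\ell^k}$, $x^{r^k}$ for the $k$-fold application of ${}^\ell$, ${}^r$. It is $n$-periodic if it satisfies $x^{\ell^n}\approx x^{r^n}$, and periodic if it is $n$-periodic for some $n\in\mathbb{Z}^+$. The group skeleton of $\mathbf{L}$ is the subalgebra $\mathbf{L}_g$ with universe $L_g=\{a\in L: a^\ell=a^r\}$; it is an $\ell$-group consisting of the invertible elements of $\mathbf{L}$. $\mathcal{C}(\mathbf{M})$ denotes the lattice, under inclusion, of convex subalgebras (subuniverses that are convex with respect to the lattice order) of $\mathbf{M}$. The convex closure of $K\subseteq L$ in $\mathbf{L}$ is $\{a\in L: c\le a\le d\text{ for some }c,d\in K\}$. *)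

(* Defs.v *)
From HB Require Import structures.
From mathcomp Require Import all_boot all_order.
From mathcomp Require Import boolp classical_sets.

Set Implicit Arguments.
Unset Strict Implicit.
Unset Printing Implicit Defensive.

Import Order.TTheory.

Local Open Scope order_scope.
Local Open Scope group_scope.

(* [ladj a] is the left inverse a^ell and [radj a] is the right inverse a^r;
   neither is a group inverse in general. *)
HB.mixin Record isLPregroup (d : Order.disp_t) L
    of Order.Lattice d L & Monoid L := {
  ladj : L -> L;
  radj : L -> L;
  lpg_leMl : forall c a b : L, a <= b -> c * a <= c * b;
  lpg_leMr : forall c a b : L, a <= b -> a * c <= b * c;
  ladj_mul_le1 : forall a : L, ladj a * a <= 1 :> L;
  ladj_mul_ge1 : forall a : L, (1 : L) <= a * ladj a;
  radj_mul_le1 : forall a : L, a * radj a <= 1 :> L;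
  radj_mul_ge1 : forall a : L, (1 : L) <= radj a * a }.

#[short(type="lpregroupType")]
HB.structure Definition LPregroup (d : Order.disp_t) :=
  {L of Order.Lattice d L & Monoid L & isLPregroup d L}.

Arguments ladj {d s} : rename.
Arguments radj {d s} : rename.
Arguments lpg_leMl {d s} c [a b] : rename.
Arguments lpg_leMr {d s} c [a b] : rename.

Definition n_periodic d (L : lpregroupType d) (n : nat) :=
  forall x : L, iter n ladj x = iter n radj x.

Definition periodic d (L : lpregroupType d) :=
  exists2 n, (0 < n)%N & n_periodic L n.

Section LPregroupTheory.
Variables (d : Order.disp_t) (L : lpregroupType d).
Implicit Types a b c : L.

Lemma ladj_unique a b : b * a <= 1 :> L -> (1 : L) <= a * b -> ladj a = b.
Proof.
move=> ba1 ab1; apply/le_anti/andP; split.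
  have := lpg_leMl (ladj a) ab1; rewrite mulg1 mulgA => /le_trans; apply.
  by rewrite -[leRHS]mul1g lpg_leMr ?ladj_mul_le1.
have := lpg_leMl b (ladj_mul_ge1 a); rewrite mulg1 mulgA => /le_trans.
by apply; rewrite -[leRHS]mul1g lpg_leMr.
Qed.

Lemma radj_unique a b : a * b <= 1 :> L -> (1 : L) <= b * a -> radj a = b.
Proof.
move=> ab1 ba1; apply/le_anti/andP; split.
  have := lpg_leMr (radj a) ba1; rewrite mul1g -mulgA => /le_trans.
  by apply; rewrite -[leRHS]mulg1 lpg_leMl ?radj_mul_le1.
have := lpg_leMr b (radj_mul_ge1 a); rewrite mul1g -mulgA => /le_trans.
by apply; rewrite -[leRHS]mulg1 lpg_leMl.
Qed.

Lemma radjK a : ladj (radj a) = a.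
Proof. exact: ladj_unique (radj_mul_le1 a) (radj_mul_ge1 a). Qed.

Lemma ladjK a : radj (ladj a) = a.
Proof. exact: radj_unique (ladj_mul_le1 a) (ladj_mul_ge1 a). Qed.

Lemma ladj_anti a b : a <= b -> ladj b <= ladj a.
Proof.
move=> ab; have := lpg_leMl (ladj b) (ladj_mul_ge1 a).
rewrite mulg1 mulgA => /le_trans; apply; rewrite -[leRHS]mul1g lpg_leMr //.
exact: le_trans (lpg_leMl _ ab) (ladj_mul_le1 b).
Qed.

Lemma radj_anti a b : a <= b -> radj b <= radj a.
Proof.
move=> ab; have := lpg_leMr (radj b) (radj_mul_ge1 a).
rewrite mul1g -mulgA => /le_trans; apply; rewrite -[leRHS]mulg1 lpg_leMl //.
exact: le_trans (lpg_leMr _ ab) (radj_mul_le1 b).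
Qed.

Lemma ladjI a b : ladj (Order.meet a b) = Order.join (ladj a) (ladj b).
Proof.
apply/le_anti; rewrite leUx !ladj_anti ?leIl ?leIr // !andbT.
rewrite -[leRHS]radjK; apply: ladj_anti; rewrite lexI.
by rewrite -[X in _ <= X]ladjK -[X in _ && (_ <= X)]ladjK !radj_anti ?leUl ?leUr.
Qed.

Lemma radjI a b : radj (Order.meet a b) = Order.join (radj a) (radj b).
Proof.
apply/le_anti; rewrite leUx !radj_anti ?leIl ?leIr // !andbT.
rewrite -[leRHS]ladjK; apply: radj_anti; rewrite lexI.
by rewrite -[X in _ <= X]radjK -[X in _ && (_ <= X)]radjK !ladj_anti ?leUl ?leUr.
Qed.

Lemma ladjU a b : ladj (Order.join a b) = Order.meet (ladj a) (ladj b).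
Proof. by rewrite -[RHS]radjK radjI !ladjK. Qed.

Lemma radjU a b : radj (Order.join a b) = Order.meet (radj a) (radj b).
Proof. by rewrite -[RHS]ladjK ladjI !radjK. Qed.

Lemma ladjM a b : ladj (a * b) = ladj b * ladj a.
Proof.
apply: ladj_unique.
  apply: le_trans (ladj_mul_le1 b); rewrite -mulgA lpg_leMl // mulgA.
  by rewrite -[leRHS]mul1g lpg_leMr ?ladj_mul_le1.
apply: le_trans (ladj_mul_ge1 a) _; rewrite -mulgA lpg_leMl // mulgA.
by rewrite -[leLHS]mul1g lpg_leMr ?ladj_mul_ge1.
Qed.

Lemma radjM a b : radj (a * b) = radj b * radj a.
Proof.
apply: radj_unique.
  apply: le_trans (radj_mul_le1 a); rewrite -mulgA lpg_leMl // mulgA.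
  by rewrite -[leRHS]mul1g lpg_leMr ?radj_mul_le1.
apply: le_trans (radj_mul_ge1 b) _; rewrite -mulgA lpg_leMl // mulgA.
by rewrite -[leLHS]mul1g lpg_leMr ?radj_mul_ge1.
Qed.

Lemma ladj1 : ladj (1 : L) = 1.
Proof. by apply: ladj_unique; rewrite mulg1. Qed.

Lemma radj1 : radj (1 : L) = 1.
Proof. by apply: radj_unique; rewrite mulg1. Qed.

End LPregroupTheory.

Section GroupSkeleton.
Variables (d : Order.disp_t) (L : lpregroupType d).

Definition in_group_skeleton : {pred L} := [pred a : L | ladj a == radj a].

(* The subalgebra L_g as a type of its own, so that it inherits the whole
   l-pregroup structure of L and the notions below apply to it as to L. *)
Record group_skeleton :=
  GroupSkeleton { skval :> L; skvalP : in_group_skeleton skval }.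

HB.instance Definition _ := [isSub for skval].
HB.instance Definition _ := [Choice of group_skeleton by <:].

Fact skel_meet_closed : meet_closed in_group_skeleton.
Proof.
by move=> a b; rewrite !inE => /eqP ea /eqP eb; rewrite ladjI radjI ea eb.
Qed.

Fact skel_join_closed : join_closed in_group_skeleton.
Proof.
by move=> a b; rewrite !inE => /eqP ea /eqP eb; rewrite ladjU radjU ea eb.
Qed.

Fact skel_monoid_closed : monoid_closed in_group_skeleton.
Proof.
split=> [|a b]; rewrite !inE; first by rewrite ladj1 radj1.
by move=> /eqP ea /eqP eb; rewrite ladjM radjM ea eb.
Qed.

HB.instance Definition _ :=
  Order.SubChoice_isSubLattice.Build d L in_group_skeleton d group_skeleton
    skel_meet_closed skel_join_closed.
HB.instance Definition _ :=
  SubChoice_isSubMonoid.Build L in_group_skeleton group_skeleton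
    skel_monoid_closed.

Fact skel_ladj_subproof (a : group_skeleton) :
  in_group_skeleton (ladj (skval a)).
Proof. by have /eqP e := skvalP a; apply/eqP; rewrite ladjK e radjK. Qed.

Fact skel_radj_subproof (a : group_skeleton) :
  in_group_skeleton (radj (skval a)).
Proof. by have /eqP e := skvalP a; apply/eqP; rewrite -e ladjK e radjK. Qed.

Definition skel_ladj (a : group_skeleton) := GroupSkeleton (skel_ladj_subproof a).
Definition skel_radj (a : group_skeleton) := GroupSkeleton (skel_radj_subproof a).

Fact skel_leMl (c a b : group_skeleton) : a <= b -> c * a <= c * b.
Proof. by rewrite -!Order.le_val !valM; apply: lpg_leMl. Qed.
Fact skel_leMr (c a b : group_skeleton) : a <= b -> a * c <= b * c.
Proof. by rewrite -!Order.le_val !valM; apply: lpg_leMr. Qed.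
Fact skel_ladj_mul_le1 (a : group_skeleton) :
  skel_ladj a * a <= 1 :> group_skeleton.
Proof. by rewrite -Order.le_val valM val1; apply: ladj_mul_le1. Qed.
Fact skel_ladj_mul_ge1 (a : group_skeleton) :
  (1 : group_skeleton) <= a * skel_ladj a.
Proof. by rewrite -Order.le_val valM val1; apply: ladj_mul_ge1. Qed.
Fact skel_radj_mul_le1 (a : group_skeleton) :
  a * skel_radj a <= 1 :> group_skeleton.
Proof. by rewrite -Order.le_val valM val1; apply: radj_mul_le1. Qed.
Fact skel_radj_mul_ge1 (a : group_skeleton) :
  (1 : group_skeleton) <= skel_radj a * a.
Proof. by rewrite -Order.le_val valM val1; apply: radj_mul_ge1. Qed.

HB.instance Definition _ := isLPregroup.Build d group_skeleton
  skel_leMl skel_leMr skel_ladj_mul_le1 skel_ladj_mul_ge1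
  skel_radj_mul_le1 skel_radj_mul_ge1.

End GroupSkeleton.

Local Open Scope classical_set_scope.

Section ConvexSubalgebras.
Variables (d : Order.disp_t) (M : lpregroupType d).
Implicit Types H K : set M.

Definition subuniverse H : Prop :=
  [/\ (forall a b, H a -> H b -> H (Order.meet a b)),
      (forall a b, H a -> H b -> H (Order.join a b)),
      H 1,
      (forall a b, H a -> H b -> H (a * b)) &
      (forall a, H a -> H (ladj a) /\ H (radj a))].

Definition order_convex H : Prop :=
  forall a b c, H a -> H c -> a <= b -> b <= c -> H b.

Definition convex_subuniverse H : Prop := subuniverse H /\ order_convex H.

Definition convex_closure K : set M :=
  [set a | exists c d, [/\ K c, K d, c <= a & a <= d]].

(* The lattice C(M), ordered by inclusion; the join is the convex subalgebra
   generated by the union. *)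
Record convex_subalgebra := ConvexSubalgebra {
  csub_set :> set M;
  csub_convex : convex_subuniverse csub_set }.

Lemma csub_inj (A B : convex_subalgebra) :
  csub_set A = csub_set B -> A = B.
Proof.
case: A B => [A cA] [B cB] /= eAB; subst B.
by rewrite (Prop_irrelevance cA cB).
Qed.

HB.instance Definition _ := gen_eqMixin convex_subalgebra.
HB.instance Definition _ := gen_choiceMixin convex_subalgebra.

Fact csub_display : Order.disp_t. Proof. exact: Order.Disp tt tt. Qed.

Definition csub_le (A B : convex_subalgebra) := `[< csub_set A `<=` B >].

Fact csub_le_refl : reflexive csub_le.
Proof. by move=> A; apply/asboolP. Qed.
Fact csub_le_anti : antisymmetric csub_le.
Proof.
move=> A B /andP[/asboolP AB /asboolP BA].
by apply: csub_inj; apply/seteqP.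
Qed.
Fact csub_le_trans : transitive csub_le.
Proof.
move=> B A C /asboolP AB /asboolP BC; apply/asboolP.
exact: subset_trans AB BC.
Qed.

HB.instance Definition _ := Order.Le_isPOrder.Build csub_display
  convex_subalgebra csub_le_refl csub_le_anti csub_le_trans.

Fact convex_subuniverse_bigcap (F : set (set M)) :
  F `<=` convex_subuniverse -> convex_subuniverse (\bigcap_(A in F) A).
Proof.
move=> FP; split; [split|].
- by move=> a b Ha Hb A FA; have [[h _ _ _ _] _] := FP _ FA; apply: h; [apply: Ha|apply: Hb].
- by move=> a b Ha Hb A FA; have [[_ h _ _ _] _] := FP _ FA; apply: h; [apply: Ha|apply: Hb].
- by move=> A FA; have [[_ _ h _ _] _] := FP _ FA.
- by move=> a b Ha Hb A FA; have [[_ _ _ h _] _] := FP _ FA; apply: h; [apply: Ha|apply: Hb].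
- by move=> a Ha; split=> A FA; have [[_ _ _ _ h] _] := FP _ FA;
    have [] := h _ (Ha _ FA).
move=> a b c Ha Hc ab bc A FA; have [_ cvA] := FP _ FA.
exact: (cvA a b c (Ha _ FA) (Hc _ FA)).
Qed.

Fact csub_meet_subproof (A B : convex_subalgebra) :
  convex_subuniverse (csub_set A `&` csub_set B).
Proof.
rewrite -[X in X `&` _](bigcap_set1 id) -[X in _ `&` X](bigcap_set1 id).
rewrite -bigcap_setU.
by apply: convex_subuniverse_bigcap => C [->|->]; apply: csub_convex.
Qed.

Fact csub_join_subproof (A B : convex_subalgebra) :
  convex_subuniverse (smallest convex_subuniverse (csub_set A `|` csub_set B)).
Proof. by apply: convex_subuniverse_bigcap => C []. Qed.

Definition csub_meet (A B : convex_subalgebra) :=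
  ConvexSubalgebra (csub_meet_subproof A B).
Definition csub_join (A B : convex_subalgebra) :=
  ConvexSubalgebra (csub_join_subproof A B).

Fact csub_lexI (A B C : convex_subalgebra) :
  (A <= csub_meet B C) = (A <= B) && (A <= C).
Proof.
apply/asboolP/andP => [ABC|[/asboolP AB /asboolP AC]]; last by rewrite subsetI.
by split; apply/asboolP => a /ABC[].
Qed.

Fact csub_leUx (A B C : convex_subalgebra) :
  (csub_join A B <= C) = (A <= C) && (B <= C).
Proof.
apply/asboolP/andP => [ABC|[/asboolP AC /asboolP BC]].
  by split; apply/asboolP => a Ha; apply: ABC => D [_]; apply; [left|right].
by apply: smallest_sub; [apply: csub_convex | rewrite subUset].
Qed.

HB.instance Definition _ := Order.POrder_MeetJoin_isLattice.Build csub_display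
  convex_subalgebra csub_lexI csub_leUx.

End ConvexSubalgebras.

(* Main.v *)
Require Import Defs.
From mathcomp Require Import all_boot all_order.
From mathcomp Require Import boolp classical_sets.

(** Since [ladj] is an order anti-automorphism, its square [dladj] is an
    order automorphism, and the elements it fixes are exactly those of the
    group skeleton.  Periodicity makes [dladj] of finite order, so the join of
    the orbit of an element [a] is a finite join: it bounds [a] from above, it
    is fixed by [dladj], and it lies in every subuniverse that contains [a]
    ([skeleton_upper_bound]).  Applied to the left adjoint of [a], this also
    gives a lower bound in the skeleton.  Hence every element of a convex
    subalgebra [H] lies between two elements of [H] in the skeleton, which says
    that [H] is the convex closure of its trace on the skeleton.

    The other composite is the identity because [K] is already convex inside
    the skeleton, and the convex closure of [K] is a subuniverse because all
    operations are monotone or antitone in each argument.  Both maps preserve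
    inclusion, and mutually inverse monotone maps between lattices preserve
    meets and joins. *)

Import Order.TTheory.

Local Open Scope classical_set_scope.
Local Open Scope order_scope.
Local Open Scope group_scope.

(** * Monotone bijections of lattices *)

Section OrderIsomorphism.
Context {dA dB : Order.disp_t} {A : latticeType dA} {B : latticeType dB}.
Context {f : A -> B} {g : B -> A}.
Hypotheses (f_homo : {homo f : x y / x <= y}) (g_homo : {homo g : x y / x <= y}).
Hypotheses (fK : cancel f g) (gK : cancel g f).

Lemma order_iso_meet : {morph f : x y / Order.meet x y}.
Proof.
move=> x y; apply/le_anti; rewrite lexI !f_homo ?leIl ?leIr //=.
rewrite -[leLHS]gK f_homo // lexI.
by rewrite -[X in _ <= X]fK -[X in _ && (_ <= X)]fK !g_homo ?leIl ?leIr.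
Qed.

Lemma order_iso_join : {morph f : x y / Order.join x y}.
Proof.
move=> x y; apply/le_anti; rewrite leUx !f_homo ?leUl ?leUr // !andbT.
rewrite -[leRHS]gK f_homo // leUx.
by rewrite -[X in X <= _]fK -[X in _ && (X <= _)]fK !g_homo ?leUl ?leUr.
Qed.

End OrderIsomorphism.

(** * Skeleton bounds from finite orbits *)

Section DoubleLeftAdjoint.
Context {d : Order.disp_t} {L : lpregroupType d}.
Implicit Types (a b x : L) (H : set L).

Definition dladj a : L := ladj (ladj a).

Lemma dladj_homo : {homo dladj : a b / a <= b}.
Proof. by move=> a b ab; do 2!apply: ladj_anti. Qed.

Lemma dladjU : {morph dladj : a b / Order.join a b}.
Proof. by move=> a b; rewrite /dladj ladjU ladjI. Qed.

Lemma dladj_fixed a : dladj a = a -> ladj a = radj a.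
Proof. by move=> e; rewrite -{2}e ladjK. Qed.

Lemma iter_ladj_radjK n : cancel (iter n radj) (iter n (@ladj d L)).
Proof. by elim: n => // n IHn a; rewrite iterSr /= radjK IHn. Qed.

Lemma iter_dladj_id {n} : n_periodic L n -> iter n dladj =1 id.
Proof.
move=> perL a; rewrite -[iter n dladj]/(iter n (iter 2 ladj)) -iterM muln2.
by rewrite -addnn iterD (perL a) iter_ladj_radjK.
Qed.

(** The join of [a], [dladj a], ..., [iter m dladj a]; this recursive form
    serves because a lattice need not have a least element for the empty
    join. *)
Definition orbit_join a m : L := iter m (fun x => Order.join a (dladj x)) a.

Lemma orbit_joinS a m :
  orbit_join a m.+1 = Order.join (orbit_join a m) (iter m.+1 dladj a).
Proof.
elim: m => // m IHm; rewrite {1}/orbit_join iterS -/(orbit_join a m.+1).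
by rewrite {1}IHm dladjU joinA.
Qed.

Lemma le_orbit_join a m : a <= orbit_join a m.
Proof. by case: m => //= m; apply: leUl. Qed.

Lemma subuniverse_orbit_join {H} :
  subuniverse H -> forall a m, H a -> H (orbit_join a m).
Proof.
move=> [_ HU _ _ Hadj] a m Ha; elim: m => //= m IHm; apply: (HU _ _ Ha).
by apply: (Hadj _ _).1; apply: (Hadj _ IHm).1.
Qed.

(** A full orbit absorbs its own translate, so its join [x] satisfies
    [dladj x <= x]; equality follows by going around the cycle. *)
Lemma dladj_orbit_join m a :
  n_periodic L m.+1 -> dladj (orbit_join a m) = orbit_join a m.
Proof.
move=> perL; have cycle := iter_dladj_id perL; set x := orbit_join a m.
have le_x : dladj x <= x.
  have e : orbit_join a m.+1 = x.
    by rewrite orbit_joinS cycle; apply/join_idPl; apply: le_orbit_join.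
  by rewrite -[leRHS]e; apply: leUr.
have iter_le k : iter k dladj x <= x.
  by elim: k => //= k IHk; apply: le_trans (dladj_homo _ _ IHk) le_x.
by apply/le_anti; rewrite le_x -[leLHS]cycle dladj_homo ?iter_le.
Qed.

Hypothesis perL : periodic L.

Lemma skeleton_upper_bound {H} a : subuniverse H -> H a ->
  exists b, [/\ H b, ladj b = radj b & a <= b].
Proof.
case: perL => -[//|m] _ perm subH Ha; exists (orbit_join a m).
split; [exact: subuniverse_orbit_join| |exact: le_orbit_join].
exact/dladj_fixed/dladj_orbit_join.
Qed.

Lemma skeleton_lower_bound {H} a : subuniverse H -> H a ->
  exists b, [/\ H b, ladj b = radj b & b <= a].
Proof.
move=> subH Ha; have [_ _ _ _ Hadj] := subH.
have [b [Hb eb le_b]] := skeleton_upper_bound (ladj a) subH (Hadj _ Ha).1.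
exists (radj b); split; first exact: (Hadj _ Hb).2.
  by rewrite radjK -eb ladjK.
by rewrite -[leRHS]ladjK radj_anti.
Qed.

End DoubleLeftAdjoint.

(** * Traces on the skeleton and convex closures *)

Section TraceAndClosure.
Context {d : Order.disp_t} {L : lpregroupType d}.

Lemma trace_convex_subuniverse (H : convex_subalgebra L) :
  convex_subuniverse (skval (L:=L) @^-1` csub_set H).
Proof.
have [[HI HU H1 HM Hadj] Hconv] := csub_convex H.
split; last by move=> a b c Ha Hc ab bc; apply: (Hconv _ _ _ Ha Hc).
split=> //=; first by move=> a b; apply: HI.
- by move=> a b; apply: HU.
- by move=> a b; apply: HM.
- by move=> a; apply: Hadj.
Qed.

Definition trace (H : convex_subalgebra L) : convex_subalgebra (group_skeleton L) :=
  ConvexSubalgebra (trace_convex_subuniverse H).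

Lemma image_trace (H : convex_subalgebra L) :
  skval (L:=L) @` csub_set (trace H) =
    csub_set H `&` [set a : L | ladj a = radj a].
Proof.
apply/seteqP; split=> [_ [a Ha <-]|a [Ha /eqP skel_a]].
  by split=> //; apply/eqP/skvalP.
by exists (GroupSkeleton skel_a).
Qed.

Lemma closure_convex_subuniverse (K : convex_subalgebra (group_skeleton L)) :
  convex_subuniverse (convex_closure (skval (L:=L) @` csub_set K)).
Proof.
have [[KI KU K1 KM Kadj] _] := csub_convex K.
split; [split|].
- move=> a b [_ [_ [[p Kp <-] [q Kq <-] pa aq]]].
  move=> [_ [_ [[r Kr <-] [s Ks <-] rb bs]]].
  exists (Order.meet (skval p) (skval r)), (Order.meet (skval q) (skval s)).
  split; [by exists (Order.meet p r); first exact: KI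
         |by exists (Order.meet q s); first exact: KI| |]; exact: leI2.
- move=> a b [_ [_ [[p Kp <-] [q Kq <-] pa aq]]].
  move=> [_ [_ [[r Kr <-] [s Ks <-] rb bs]]].
  exists (Order.join (skval p) (skval r)), (Order.join (skval q) (skval s)).
  split; [by exists (Order.join p r); first exact: KU
         |by exists (Order.join q s); first exact: KU| |]; exact: leU2.
- by exists 1, 1; split=> //; exists 1.
- move=> a b [_ [_ [[p Kp <-] [q Kq <-] pa aq]]].
  move=> [_ [_ [[r Kr <-] [s Ks <-] rb bs]]].
  exists (skval p * skval r), (skval q * skval s).
  split; [by exists (p * r); first exact: KM
         |by exists (q * s); first exact: KM| |].
    exact: le_trans (lpg_leMl _ rb) (lpg_leMr _ pa).
  exact: le_trans (lpg_leMl _ bs) (lpg_leMr _ aq).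
- move=> a [_ [_ [[p Kp <-] [q Kq <-] pa aq]]].
  have [[Klp Krp] [Klq Krq]] := (Kadj _ Kp, Kadj _ Kq).
  split; [exists (ladj (skval q)), (ladj (skval p))
         |exists (radj (skval q)), (radj (skval p))].
    by split; [exists (ladj q)|exists (ladj p)| |]; rewrite ?ladj_anti.
  by split; [exists (radj q)|exists (radj p)| |]; rewrite ?radj_anti.
- move=> a b c [p [_ [Kp _ pa _]]] [_ [q [_ Kq _ cq]]] ab bc.
  by exists p, q; split=> //; [exact: le_trans pa ab|exact: le_trans bc cq].
Qed.

Definition closure (K : convex_subalgebra (group_skeleton L)) : convex_subalgebra L :=
  ConvexSubalgebra (closure_convex_subuniverse K).

Lemma trace_homo : {homo trace : H K / H <= K}.
Proof. by move=> H K /asboolP HK; apply/asboolP => a /HK. Qed.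

Lemma closure_homo : {homo closure : H K / H <= K}.
Proof.
move=> H K /asboolP HK; apply/asboolP => a.
by move=> [p [q [Hp Hq pa aq]]]; exists p, q; split=> //; apply: image_subset HK _ _.
Qed.

Lemma closureK : cancel closure trace.
Proof.
move=> K; apply/csub_inj/seteqP; split=> [a|a Ka].
  move=> [_ [_ [[p Kp <-] [q Kq <-] pa aq]]].
  exact: ((csub_convex K).2 p a q).
by exists (skval a), (skval a); split=> //; exists a.
Qed.

Lemma traceK : periodic L -> cancel trace closure.
Proof.
move=> perL H; have [subH convH] := csub_convex H.
apply/csub_inj/seteqP; split=> [a|a Ha].
  move=> [_ [_ [[p Hp <-] [q Hq <-] pa aq]]].
  exact: (convH (skval p) a (skval q)).
have [p [Hp ep pa]] := skeleton_lower_bound perL _ subH Ha.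
have [q [Hq eq aq]] := skeleton_upper_bound perL _ subH Ha.
by exists p, q; rewrite image_trace.
Qed.

End TraceAndClosure.

Theorem theorem2p13 (d : Order.disp_t) (L : lpregroupType d) (Lper : periodic L) :
  exists (f : convex_subalgebra L -> convex_subalgebra (group_skeleton L))
         (g : convex_subalgebra (group_skeleton L) -> convex_subalgebra L),
    [/\ (forall H : convex_subalgebra L,
           skval (L:=L) @` csub_set (f H) =
             csub_set H `&` [set a : L | ladj a = radj a]),
        (forall K : convex_subalgebra (group_skeleton L),
           csub_set (g K) = convex_closure (skval (L:=L) @` csub_set K)),
        cancel f g,
        cancel g f &
        [/\ {morph f : H K / Order.meet H K},
            {morph f : H K / Order.join H K},
            {morph g : H K / Order.meet H K} &
            {morph g : H K / Order.join H K}]].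
Proof.
exists trace, closure; have trK := traceK Lper; have clK := @closureK d L.
have tr_homo := @trace_homo d L; have cl_homo := @closure_homo d L.
split=> //; [exact: image_trace|split].
- exact: order_iso_meet tr_homo cl_homo trK clK.
- exact: order_iso_join tr_homo cl_homo trK clK.
- exact: order_iso_meet cl_homo tr_homo clK trK.
- exact: order_iso_join cl_homo tr_homo clK trK.
Qed.
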